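(* Let $Q$ be a real symmetric $n\times n$ matrix with nonnegative entries, and let $\Delta=\{x\in\mathbf{R}^n: x\ge 0,\ \sum_{i=1}^n x_i=1\}$ be the standard simplex. For a symmetric matrix $S$ let $\ell_S=\min\{x^TSx: x\in\Delta\}$. Then the quantity $$\ell_Q^{conv}=\sup\{\ell_S:\ S\succeq 0,\ Q-S\ge 0,\ \mathrm{diag}(S)=\mathrm{diag}(Q)\}$$ is equal to the optimal value of the problem $$\begin{array}{ll}\max&\ell\\ \text{s.t.}& x^TQx-\ell+\sum_{i=1}^n\alpha_i(x)(-x_i)+\alpha_{n+1}(x)(e^Tx-1)\in P[x],\\ &\alpha_i\in\mathcal{A}_+(\Delta),\ i=1,\dots,n,\end{array}$$ where the variables are $\ell\in\mathbf{R}$ and affine functions $\alpha_1,\dots,\alpha_{n+1}:\mathbf{R}^n\to\mathbf{R}$ ($\alpha_{n+1}$ being an arbitrary affine function).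
   Context: $P[x]$ is the set of polynomials nonnegative on $\mathbf{R}^n$. $\mathcal{A}_+(\Delta)$ is the set of affine functions $\mathbf{R}^n\to\mathbf{R}$ that are nonnegative on $\Delta$. $e$ is the all-ones vector. $S\succeq0$ means that the symmetric matrix $S$ is positive semidefinite, $Q-S\ge0$ means that all entries of $Q-S$ are nonnegative, and $\mathrm{diag}(S)$ is the diagonal of $S$. *)

(* Defs.v *)
From mathcomp Require Import all_boot all_order all_algebra.
From mathcomp Require Import classical_sets boolp reals constructive_ereal ereal.
(* Not imported: its notations clash with those of MathComp-Analysis. *)
From mathcomp Require mpoly.

Set Implicit Arguments.
Unset Strict Implicit.
Unset Printing Implicit Defensive.

Import Order.TTheory GRing.Theory Num.Theory.

Local Open Scope classical_set_scope.
Local Open Scope ring_scope.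

Definition is_min (R : realType) (A : set R) (m : R) : Prop :=
  A m /\ lbound A m.

Definition ones (R : realType) (n : nat) : 'cV[R]_n := const_mx 1.
Arguments ones : clear implicits.

Definition simplex (R : realType) (n : nat) : set 'cV[R]_n :=
  [set x | (forall i, 0 <= x i 0) /\ \sum_i x i 0 = 1].
Arguments simplex : clear implicits.

Definition quad (R : realType) (n : nat) (S : 'M[R]_n) (x : 'cV[R]_n) : R :=
  (x^T *m S *m x) 0 0.

Definition nonneg_mx (R : realType) (n : nat) (M : 'M[R]_n) : Prop :=
  forall i j, 0 <= M i j.

Definition psd (R : realType) (n : nat) (S : 'M[R]_n) : Prop :=
  S^T = S /\ forall x : 'cV[R]_n, 0 <= quad S x.

Definition diag (R : realType) (n : nat) (S : 'M[R]_n) : 'rV[R]_n :=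
  \row_i S i i.

(* The value of the minimum of x^T S x over the simplex enters as a relation,
   so that no default value is involved. *)
Definition conv_values (R : realType) (n : nat) (Q : 'M[R]_n) : set R :=
  [set l | exists S : 'M[R]_n,
    [/\ psd S, nonneg_mx (Q - S), diag S = diag Q
      & is_min [set quad S x | x in simplex R n] l]].

Definition l_conv (R : realType) (n : nat) (Q : 'M[R]_n) : \bar R :=
  ereal_sup [set l%:E | l in conv_values Q].

Definition affine_fun (R : realType) (n : nat) : set ('cV[R]_n -> R) :=
  [set f | exists (c : 'cV[R]_n) (d : R), forall x : 'cV[R]_n,
    f x = (c^T *m x) 0 0 + d].

Definition affine_nonneg (R : realType) (n : nat) (D : set 'cV[R]_n) :
    set ('cV[R]_n -> R) :=
  [set f | affine_fun f /\ forall x, D x -> 0 <= f x].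

(* Since R is infinite, a polynomial in n variables is identified with the
   function it induces on R^n. *)
Definition poly_fun (R : realType) (n : nat) : set ('cV[R]_n -> R) :=
  [set f | exists p : mpoly.mpoly n R,
    forall x : 'cV[R]_n, f x = mpoly.meval (fun i => x i 0) p].

Definition poly_nonneg (R : realType) (n : nat) : set ('cV[R]_n -> R) :=
  [set f | poly_fun f /\ forall x, 0 <= f x].

Definition feasible (R : realType) (n : nat) (Q : 'M[R]_n) (l : R)
    (alpha : 'I_n -> 'cV[R]_n -> R) (beta : 'cV[R]_n -> R) : Prop :=
  [/\ forall i, affine_nonneg (simplex R n) (alpha i),
      affine_fun beta
    & poly_nonneg (fun x => quad Q x - l + \sum_i alpha i x * (- x i 0)
                            + beta x * (((ones R n)^T *m x) 0 0 - 1))].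

Definition feasible_values (R : realType) (n : nat) (Q : 'M[R]_n) : set R :=
  [set l | exists alpha beta, feasible Q l alpha beta].

Definition optimal_value (R : realType) (n : nat) (Q : 'M[R]_n) : \bar R :=
  ereal_sup [set l%:E | l in feasible_values Q].

(* Main.v *)
Require Import Defs.
From mathcomp Require Import all_boot all_order all_algebra.
From mathcomp Require Import classical_sets boolp reals constructive_ereal ereal.
From mathcomp Require Import topology normedtype derive.
From mathcomp Require Import ring lra.
From mathcomp Require mpoly.

Set Implicit Arguments.
Unset Strict Implicit.
Unset Printing Implicit Defensive.

Import Order.TTheory GRing.Theory Num.Theory numFieldNormedType.Exports.

Local Open Scope classical_set_scope.
Local Open Scope ring_scope.

(* If [S] is admissible with minimum [l] on the simplex, attained at [y], then
   the first-order conditions [(S y)_i >= l] turn [quad S (x - y)] into a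
   certificate for [l]. Conversely, on the hyperplane [sum x = 1] a certificate
   gives [x^T (Q - M) x >= l] with [M >= 0] symmetric; homogenizing,
   [Q - M - l 1 1^T] is positive semidefinite, so for [l >= 0] adding back the
   diagonal of [M] produces an admissible [S] whose minimum is at least [l];
   negative [l] are beaten by [S = diag Q]. The supremum is attained because
   the admissible [S] form a compact set, their entries being bounded by
   those of [Q]. *)

(** * Closure properties of polynomial functions *)

Section PolynomialFunctions.
Variables (R : realType) (n : nat).
Implicit Types f g : 'cV[R]_n -> R.

Lemma poly_fun_coord i : poly_fun (fun x : 'cV[R]_n => x i 0).
Proof.
by exists (mpoly.mpolyX R (mpoly.mnm1 i)) => x; rewrite mpoly.mevalXU.
Qed.

Lemma poly_fun_cst c : poly_fun (fun _ : 'cV[R]_n => c).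
Proof. by exists (mpoly.mpolyC n c) => x; rewrite mpoly.mevalC. Qed.

Lemma poly_funD f g :
  poly_fun f -> poly_fun g -> poly_fun (fun x => f x + g x).
Proof. by case=> p fp [q gq]; eexists => x; rewrite fp gq -mpoly.mevalD. Qed.

Lemma poly_funM f g :
  poly_fun f -> poly_fun g -> poly_fun (fun x => f x * g x).
Proof. by case=> p fp [q gq]; eexists => x; rewrite fp gq -mpoly.mevalM. Qed.

Lemma poly_fun_sum (I : Type) (r : seq I) (F : I -> 'cV[R]_n -> R) :
  (forall i, poly_fun (F i)) -> poly_fun (fun x => \sum_(i <- r) F i x).
Proof.
move=> polyF; elim: r => [|i r IHr].
  by rewrite (_ : (fun _ => _) = fun=> 0); [exact: poly_fun_cst |
    apply/funext => x; rewrite big_nil].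
rewrite (_ : (fun _ => _) = fun x => F i x + \sum_(i <- r) F i x).
  exact: poly_funD.
by apply/funext => x; rewrite big_cons.
Qed.

End PolynomialFunctions.

(** * Quadratic forms, points of the simplex and first-order optimality *)

Section QuadraticForms.
Variables (R : realType) (n : nat).
Implicit Types (S T : 'M[R]_n) (x y : 'cV[R]_n).

Lemma quadE S x : quad S x = \sum_i x i 0 * (S *m x) i 0.
Proof. by rewrite /quad -mulmxA mxE; apply: eq_bigr => i _; rewrite mxE. Qed.

Lemma quad_sumE S x : quad S x = \sum_i \sum_j x i 0 * (S i j * x j 0).
Proof.
by rewrite quadE; apply: eq_bigr => i _; rewrite mxE mulr_sumr.
Qed.

Lemma quadDl S T x : quad (S + T) x = quad S x + quad T x.
Proof. by rewrite /quad mulmxDr mulmxDl mxE. Qed.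

Lemma quadBl S T x : quad (S - T) x = quad S x - quad T x.
Proof. by rewrite /quad mulmxBr mulmxBl !mxE. Qed.

Lemma quadZl a S x : quad (a *: S) x = a * quad S x.
Proof. by rewrite /quad -scalemxAr -scalemxAl mxE. Qed.

Lemma bilin_trmx S x y : (x^T *m S^T *m y) 0 0 = (y^T *m S *m x) 0 0.
Proof.
have tr11 (M : 'M[R]_1) : M^T 0 0 = M 0 0 by rewrite mxE.
by rewrite -[LHS]tr11 !trmx_mul !trmxK mulmxA.
Qed.

Lemma quad_trmx S x : quad S^T x = quad S x.
Proof. exact: bilin_trmx. Qed.

Lemma quadZ S a x : quad S (a *: x) = a ^+ 2 * quad S x.
Proof.
by rewrite /quad -scalemxAr linearZ /= -!scalemxAl scalerA mxE expr2.
Qed.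

Lemma quadDr S x y : S^T = S ->
  quad S (x + y) = quad S x + 2 * (x^T *m S *m y) 0 0 + quad S y.
Proof.
move=> symS; rewrite /quad mulmxDr linearD /= !mulmxDl.
rewrite [LHS]mxE [X in X + _]mxE [X in _ + X]mxE -(bilin_trmx S x y) symS.
by ring.
Qed.

Lemma quad_const1 x : quad (const_mx 1) x = (\sum_i x i 0) ^+ 2.
Proof.
rewrite quad_sumE expr2 mulr_suml; apply: eq_bigr => i _.
by rewrite mulr_sumr; apply: eq_bigr => j _; rewrite mxE mul1r.
Qed.

Lemma quad_diag (d : 'rV[R]_n) x : quad (diag_mx d) x = \sum_i d 0 i * x i 0 ^+ 2.
Proof.
rewrite quadE; apply: eq_bigr => i _.
by rewrite mul_diag_mx mxE mulrCA expr2.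
Qed.

Lemma bilin_delta x S i : (x^T *m S *m (delta_mx i 0 : 'cV_n)) 0 0 = (x^T *m S) 0 i.
Proof. by rewrite -colE mxE. Qed.

Lemma quad_delta S i : quad S (delta_mx i 0) = S i i.
Proof. by rewrite /quad bilin_delta trmx_delta -rowE mxE. Qed.

Lemma sum_delta_cV i : \sum_j (delta_mx i 0 : 'cV[R]_n) j 0 = 1.
Proof.
rewrite (bigD1 i) //= big1 ?mxE ?eqxx ?addr0 // => j /negPf ji.
by rewrite mxE ji.
Qed.

Lemma simplex_delta i : simplex R n (delta_mx i 0).
Proof. by split; [move=> j; rewrite mxE ler0n | exact: sum_delta_cV]. Qed.

Lemma simplex_segment x y t : simplex R n x -> simplex R n y -> 0 <= t <= 1 ->
  simplex R n (x + t *: (y - x)).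
Proof.
move=> [x0 x1] [y0 y1] /andP[t0 t1]; split => [i|].
  rewrite !mxE.
  have := mulr_ge0 t0 (y0 i); have : 0 <= (1 - t) * x i 0.
    by rewrite mulr_ge0 ?subr_ge0.
  by lra.
under eq_bigr do rewrite !mxE.
by rewrite big_split /= -mulr_sumr sumrB x1 y1 subrr mulr0 addr0.
Qed.

Lemma poly_fun_quad S y : poly_fun (fun x => quad S (x - y)).
Proof.
have polyB i : poly_fun (fun x : 'cV[R]_n => (x - y) i 0).
  rewrite (_ : (fun _ => _) = fun x => x i 0 + (- y i 0)).
    by apply: poly_funD; [exact: poly_fun_coord | exact: poly_fun_cst].
  by apply/funext => x; rewrite !mxE.
rewrite (_ : (fun _ => _) =
  fun x => \sum_i \sum_j (x - y) i 0 * (S i j * (x - y) j 0)).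
  apply: poly_fun_sum => i; apply: poly_fun_sum => j.
  by apply: poly_funM => //; apply: poly_funM => //; exact: poly_fun_cst.
by apply/funext => x; rewrite quad_sumE.
Qed.

(** Letting t tend to 0 removes everything but [a]; an explicit small t replaces the limit. This
    serves both for the first-order condition at a minimizer and for leaving the hyperplane where
    the coordinates sum to 0. *)
Lemma ge0_small (a b c : R) :
  (forall t, 0 < t <= 1 -> 0 <= a + t * (b + t * c)) -> 0 <= a.
Proof.
move=> H; rewrite leNgt; apply/negP => a0.
set K := `|b| + `|c|.
have K0 : 0 <= K by rewrite addr_ge0.
have D0 : 0 < K + 1 - a by lra.
(* The denominator exceeds both [K] and [- a], so [t * K < - a] and [t <= 1]: the perturbation is
   too small to compensate a negative [a]. *)
pose t := - a / (K + 1 - a).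
have t0 : 0 < t by rewrite divr_gt0 // oppr_gt0.
have t1 : t <= 1 by rewrite ler_pdivrMr // mul1r; lra.
have tK : t * K < - a.
  by rewrite /t mulrAC ltr_pdivrMr // ltr_pM2l ?oppr_gt0 //; lra.
have bc : b + t * c <= K.
  apply: lerD; first exact: ler_norm.
  apply: (le_trans (ler_norm _)); rewrite normrM (gtr0_norm t0).
  by rewrite ler_piMl.
have := H t; rewrite t0 t1 => /(_ isT).
have : t * (b + t * c) <= t * K by rewrite ler_pM2l.
by lra.
Qed.

(** Moving from the minimizer towards the i-th vertex stays in the simplex, so the derivative of the
    form in that direction, 2 ((S x)_i - l), cannot be negative. *)
Lemma quad_min_gradient S x l i : S^T = S -> simplex R n x -> quad S x = l ->
  (forall y, simplex R n y -> l <= quad S y) -> l <= (S *m x) i 0.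
Proof.
move=> symS xD Sx lmin; pose y : 'cV[R]_n := delta_mx i 0.
have bE : (x^T *m S *m (y - x)) 0 0 = (S *m x) i 0 - l.
  rewrite mulmxBr [LHS]mxE [X in _ + X]mxE -Sx /quad bilin_delta; congr (_ - _).
  by rewrite -[in LHS]symS -trmx_mul mxE.
suff : 0 <= 2 * ((S *m x) i 0 - l) by lra.
apply: (@ge0_small _ (quad S (y - x)) 0) => t /andP[t0 t1].
have := lmin _ (simplex_segment xD (simplex_delta i) (_ : 0 <= t <= 1)).
rewrite (ltW t0) t1 => /(_ isT).
rewrite quadDr // Sx quadZ -scalemxAr [X in 2 * X]mxE bE => H.
rewrite -(pmulr_rge0 _ t0); move: H; rewrite -/y.
by set q := quad _ _; nra.
Qed.

End QuadraticForms.

(** * Closed sets cut out by continuous constraints *)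

Section ContinuousConstraints.
Variables (R : realType) (T : topologicalType).
Implicit Types f g : T -> R.

Lemma cont_cst (c : R) : continuous ((fun _ => c) : T -> R).
Proof. by move=> x; exact: cvg_cst. Qed.

Lemma contN f : continuous f -> continuous (fun x => - f x).
Proof. by move=> fc x; apply: cvgN; exact: fc. Qed.

Lemma contD f g : continuous f -> continuous g ->
  continuous (fun x => f x + g x).
Proof. by move=> fc gc x; apply: cvgD; [exact: fc | exact: gc]. Qed.

Lemma contM f g : continuous f -> continuous g ->
  continuous (fun x => f x * g x).
Proof. by move=> fc gc x; apply: cvgM; [exact: fc | exact: gc]. Qed.

Lemma cont_sum (J : Type) (r : seq J) (F : J -> T -> R) :
  (forall j, continuous (F j)) -> continuous (fun x => \sum_(j <- r) F j x).
Proof.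
move=> Fc; elim: r => [|j r IHr].
  have -> : (fun x => \sum_(j <- [::]) F j x) = (fun=> 0).
    by apply/funext => x; rewrite big_nil.
  exact: cont_cst.
have -> : (fun x => \sum_(j <- j :: r) F j x) =
    (fun x => F j x + \sum_(j <- r) F j x).
  by apply/funext => x; rewrite big_cons.
exact: contD.
Qed.

Lemma closed_le_cont (f : T -> R) (c : R) :
  continuous f -> closed [set g | c <= f g].
Proof.
move=> fc; apply: (@preimage_closed _ _ f [set x : R | c <= x]).
  by move=> x _; exact: fc.
exact: closed_ge.
Qed.

Lemma closed_eq_cont (f : T -> R) (c : R) :
  continuous f -> closed [set g | f g = c].
Proof.
move=> fc; apply: (@preimage_closed _ _ f [set x : R | x = c]).
  by move=> x _; exact: fc.
exact: closed_eq.
Qed.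

Lemma closed_forall (J : Type) (P : J -> set T) :
  (forall j, closed (P j)) -> closed [set g | forall j, P j g].
Proof.
move=> Pc; rewrite (_ : [set _ | _] = \bigcap_(j in setT) P j).
  by apply: closed_bigI.
by apply/seteqP; split => g /= H; [move=> j _ | move=> j]; exact: H.
Qed.

End ContinuousConstraints.

(** * Extreme values on closed subsets of a box *)

Section BoxExtremum.
Variables (R : realType) (I : eqType).
Let T := prod_topology (fun _ : I => R).

Lemma coord_cont i : continuous ((fun g => g i) : T -> R).
Proof. exact: (@proj_continuous I (fun=> R) i). Qed.

(** By Tychonoff the box is compact, hence so is [P], and the extreme value theorem applies. The
    index type is left general to cover both vectors and matrices paired with a level. *)
Lemma box_max (lo hi : I -> R) (P : set T) (f : T -> R) :
  closed P -> continuous f -> P !=set0 ->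
  (forall g, P g -> forall i, lo i <= g i <= hi i) ->
  exists2 g, P g & forall h, P h -> f h <= f g.
Proof.
move=> Pc fc P0 Pbox.
have boxc : compact [set g : T | forall i, `[lo i, hi i]%classic (g i)].
  apply: (@tychonoff I (fun=> R) (fun i => `[lo i, hi i]%classic)) => i.
  exact: segment_compact.
have Pcompact : compact P.
  apply: (subclosed_compact Pc boxc) => g Pg i /=.
  by rewrite in_itv /=; exact: Pbox.
have [g /set_mem Pg gmax] :=
  compact_EVT_max P0 Pcompact (continuous_subspaceT fc).
by exists g => // h Ph; apply: gmax; apply/mem_set.
Qed.

End BoxExtremum.

(** * Minima on the simplex and attainment of the supremum over admissible matrices *)

Section Relaxation.
Variables (R : realType) (n : nat) (Q : 'M[R]_n).

Lemma simplex_quad_min (S : 'M[R]_n) : (0 < n)%N ->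
  exists2 x, simplex R n x & forall y, simplex R n y -> quad S x <= quad S y.
Proof.
move=> n0; pose v (g : 'I_n -> R) : 'cV[R]_n := \col_i g i.
pose T := prod_topology (fun _ : 'I_n => R).
have vK (x : 'cV[R]_n) : v (fun i => x i 0) = x.
  by apply/matrixP => i j; rewrite mxE ord1.
have [] := @box_max R 'I_n (fun=> 0) (fun=> 1)
  [set g : T | simplex R n (v g)] (fun g => - quad S (v g)).
- rewrite (_ : [set _ | _] = [set g : T | forall i, 0 <= g i] `&`
                             [set g : T | \sum_i g i = 1]).
    apply: closedI.
      by apply: closed_forall => i; apply: closed_le_cont; exact: coord_cont.
    by apply: closed_eq_cont; apply: cont_sum => i; exact: coord_cont.
  apply/seteqP; split=> g; rewrite /simplex /=.
    case=> g0; under eq_bigr do rewrite mxE.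
    by move=> g1; split => // i; have := g0 i; rewrite mxE.
  by case=> g0 g1; split => [i|]; [rewrite mxE | under eq_bigr do rewrite mxE].
(* Continuity is read off the expansion of the form as a polynomial in the coordinates. *)
- have -> : ((fun g => - quad S (v g)) : T -> R) =
    fun g => \sum_i \sum_j - (g i * (S i j * g j)).
    apply/funext => g; rewrite quad_sumE -sumrN; apply: eq_bigr => i _.
    by rewrite -sumrN; apply: eq_bigr => j _; rewrite !mxE.
  apply: cont_sum => i; apply: cont_sum => j; apply: contN.
  apply: contM; first exact: coord_cont.
  by apply: contM; [exact: cont_cst | exact: coord_cont].
- exists (fun i => (delta_mx (Ordinal n0) 0 : 'cV[R]_n) i 0).
  by rewrite /= vK; exact: simplex_delta.
- move=> g /= [g0 g1] i; have gi := g0 i; rewrite mxE in gi; rewrite gi /= -g1.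
  rewrite (bigD1 i) //= mxE lerDl; apply: sumr_ge0 => j _; exact: g0.
move=> g /= gD gmax; exists (v g) => // y yD.
by have := gmax (fun i => y i 0); rewrite /= vK lerN2; apply.
Qed.

Definition admissible (S : 'M[R]_n) : Prop :=
  [/\ psd S, nonneg_mx (Q - S) & diag S = diag Q].

(** Replacing the exact minimum by a lower bound turns the condition on the pair of [S] and [l] into
    a family of closed inequalities, as the compactness argument requires. *)
Definition conv_bound (l : R) : Prop :=
  exists2 S, admissible S & forall x, simplex R n x -> l <= quad S x.

Lemma conv_values_bound l : conv_values Q l -> conv_bound l.
Proof.
case=> S [Spsd QS dS [_ lb]]; exists S => // x xD; apply: lb; by exists x.
Qed.

Lemma conv_bound_values l : (0 < n)%N -> conv_bound l ->
  exists2 m, conv_values Q m & l <= m.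
Proof.
move=> n0 [S [Spsd QS dS] lS]; have [x xD xmin] := simplex_quad_min S n0.
exists (quad S x); last exact: lS.
exists S; split => //; split; first by exists x.
by move=> _ [y yD <-]; exact: xmin.
Qed.

Lemma diag_admissible : nonneg_mx Q -> admissible (diag_mx (diag Q)).
Proof.
move=> Q0; split.
- split=> [|x]; first exact: tr_diag_mx.
  rewrite quad_diag; apply: sumr_ge0 => i _.
  by rewrite mulr_ge0 ?sqr_ge0 // mxE.
- move=> i j; rewrite !mxE; case: eqP => [->|_]; last by rewrite mulr0n subr0.
  by rewrite mulr1n subrr.
- by apply/rowP => i; rewrite !mxE eqxx.
Qed.

Lemma conv_bound0 : nonneg_mx Q -> conv_bound 0.
Proof.
move=> Q0; exists (diag_mx (diag Q)); first exact: diag_admissible.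
by case: (diag_admissible Q0) => -[_ S0] _ _ x _; exact: S0.
Qed.

(** The upper bound is the entrywise condition on [Q - S]; the lower one comes from testing positive
    semidefiniteness on the sum of the i-th and j-th unit vectors. Together they confine the
    admissible matrices to a box. *)
Lemma admissible_entry S i j : admissible S ->
  - (Q i i + Q j j) / 2 <= S i j <= Q i j.
Proof.
case=> -[symS S0] QS dS; have dE k : S k k = Q k k.
  by have := congr1 (fun d : 'rV_n => d 0 k) dS; rewrite !mxE.
have := QS i j; rewrite !mxE subr_ge0 => ->; rewrite andbT.
have := S0 (delta_mx i 0 + delta_mx j 0).
rewrite quadDr // !quad_delta bilin_delta trmx_delta -rowE mxE !dE.
by lra.
Qed.

(** The level is maximized over pairs of a matrix and a level, seen as points of a product of copies
    of R: the index [Some (i, j)] carries an entry and [None] the level. Imposing a nonnegative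
    level bounds it from below, and the diagonal part of [Q] with level 0 shows that such pairs
    exist. *)
Lemma conv_bound_max : (0 < n)%N -> nonneg_mx Q ->
  exists m, [/\ conv_bound m, 0 <= m & forall l, 0 <= l -> conv_bound l -> l <= m].
Proof.
move=> n0 Q0; pose J := option ('I_n * 'I_n)%type.
pose T := prod_topology (fun _ : J => R).
pose M (g : T) : 'M[R]_n := \matrix_(i, j) g (Some (i, j)).
pose G (S : 'M[R]_n) (l : R) : T :=
  fun k => if k is Some p then S p.1 p.2 else l.
have MG S l : M (G S l) = S by apply/matrixP => i j; rewrite mxE.
have quad_cont x : continuous ((fun g => quad (M g) x) : T -> R).
  have -> : ((fun g => quad (M g) x) : T -> R) =
    fun g => \sum_i \sum_j x i 0 * (g (Some (i, j)) * x j 0).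
    apply/funext => g; rewrite quad_sumE; apply: eq_bigr => i _.
    by apply: eq_bigr => j _; rewrite mxE.
  apply: cont_sum => i; apply: cont_sum => j.
  apply: contM; first exact: cont_cst.
  by apply: contM; [exact: coord_cont | exact: cont_cst].
pose P := [set g : T | [/\ admissible (M g), 0 <= g None &
                          forall x, simplex R n x -> g None <= quad (M g) x]].
pose i0 := Ordinal n0.
(* The level is at most the value of the form at the vertex [i0], hence at most [Q i0 i0]. *)
have [] := @box_max R J
  (fun k => if k is Some p then - (Q p.1 p.1 + Q p.2 p.2) / 2 else 0)
  (fun k => if k is Some p then Q p.1 p.2 else Q i0 i0) P (fun g => g None).
(* Points of the simplex are quantified through a sigma type, so that this constraint too is an
   intersection of closed sets indexed by a type. *)
- rewrite (_ : P =
    [set g | forall i j, g (Some (j, i)) - g (Some (i, j)) = 0] `&`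
    [set g | forall x, 0 <= quad (M g) x] `&`
    [set g | forall i j, 0 <= Q i j - g (Some (i, j))] `&`
    [set g | forall i, g (Some (i, i)) = Q i i] `&`
    [set g | 0 <= g None] `&`
    [set g | forall x : {x | simplex R n x},
       0 <= quad (M g) (projT1 x) - g None]).
    repeat apply: closedI.
    + apply: closed_forall => i; apply: closed_forall => j.
      by apply: closed_eq_cont; apply: contD; [exact: coord_cont | apply: contN; exact: coord_cont].
    + by apply: closed_forall => x; apply: closed_le_cont.
    + apply: closed_forall => i; apply: closed_forall => j.
      apply: closed_le_cont.
      by apply: contD; [exact: cont_cst | apply: contN; exact: coord_cont].
    + by apply: closed_forall => i; apply: closed_eq_cont; exact: coord_cont.
    + by apply: closed_le_cont; exact: coord_cont.
    + apply: closed_forall => x; apply: closed_le_cont.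
      by apply: contD; [exact: quad_cont | apply: contN; exact: coord_cont].
  apply/seteqP; split=> g /=.
    case=> -[[symS S0] QS dS] g0 gS.
    split; [split; [split; [split; [split|]|]|]|].
    + move=> i j; have := congr1 (fun A : 'M_n => A i j) symS.
      by rewrite !mxE => ->; rewrite subrr.
    + exact: S0.
    + by move=> i j; have := QS i j; rewrite !mxE.
    + by move=> i; have := congr1 (fun d : 'rV_n => d 0 i) dS; rewrite !mxE.
    + exact: g0.
    + by case=> x xD /=; rewrite subr_ge0; exact: gS.
  case=> -[[[[symS S0] QS] dS] g0] gS; split=> //.
    split; first split=> //.
    + by apply/matrixP => i j; rewrite !mxE; apply/eqP; rewrite -subr_eq0 symS.
    + by move=> i j; rewrite !mxE; exact: QS.
    + by apply/rowP => i; rewrite !mxE.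
  by move=> x xD; rewrite -subr_ge0; exact: (gS (exist _ x xD)).
- exact: coord_cont.
- exists (G (diag_mx (diag Q)) 0); rewrite /P /= MG; split=> //.
    exact: diag_admissible.
  by case: (diag_admissible Q0) => -[_ S0] _ _ x _; exact: S0.
- move=> g [Sadm g0 gS] [[i j]|] /=.
    by have := admissible_entry i j Sadm; rewrite mxE.
  rewrite g0 /=; have := gS _ (simplex_delta R i0); rewrite quad_delta.
  by move/le_trans; apply; case/andP: (admissible_entry i0 i0 Sadm).
move=> g [Sadm g0 gS] gmax; exists (g None); split=> //; first by exists (M g).
by move=> l l0 [S Sad lS]; apply: (gmax (G S l)); rewrite /P /= MG.
Qed.

(** * Passage between admissible matrices and certificates *)

Hypothesis Qsym : Q^T = Q.

(* For a minimizer [y] of [quad S] over the simplex, take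
   [alpha_i x = ((Q - S) x)_i + 2 ((S y)_i - l)] and the constant [- 2 l] as
   the last multiplier: the certificate polynomial is then [quad S (x - y)]. *)
Lemma conv_values_feasible (l : R) : conv_values Q l -> feasible_values Q l.
Proof.
case=> S [[symS S0] QS dS [[y yD Sy] lb]].
have lmin z : simplex R n z -> l <= quad S z by move=> zD; apply: lb; exists z.
pose alpha i (x : 'cV[R]_n) := ((Q - S) *m x) i 0 + 2 * ((S *m y) i 0 - l).
exists alpha, (fun=> - (2 * l)); split.
- move=> i; split.
    exists (row i (Q - S))^T, (2 * ((S *m y) i 0 - l)) => x.
    by rewrite trmxK -row_mul mxE.
  move=> x [x0 _]; apply: addr_ge0.
    rewrite mxE; apply: sumr_ge0 => j _; apply: mulr_ge0; [exact: QS|exact: x0].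
  by rewrite mulr_ge0 // subr_ge0; exact: quad_min_gradient.
- by exists 0, (- (2 * l)) => x; rewrite trmx0 mul0mx mxE add0r.
have certE x : quad Q x - l + \sum_i alpha i x * - x i 0
    + - (2 * l) * (((ones R n)^T *m x) 0 0 - 1) = quad S (x - y).
  have -> : ((ones R n)^T *m x) 0 0 = \sum_i x i 0.
    by rewrite mxE; apply: eq_bigr => i _; rewrite !mxE mul1r.
  have -> : \sum_i alpha i x * - x i 0 =
      - quad (Q - S) x - 2 * (x^T *m S *m y) 0 0 + 2 * l * \sum_i x i 0.
    rewrite quadE -mulmxA [in X in _ - X + _]mxE !mulr_sumr -!sumrN -!big_split.
    by apply: eq_bigr => i _; rewrite /alpha /= [x^T _ _]mxE; ring.
  rewrite quadDr // quadBl -[- y]scaleN1r quadZ -scalemxAr Sy.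
  by rewrite [X in _ = _ + 2 * X + _]mxE; ring.
rewrite (_ : (fun _ => _) = fun x => quad S (x - y)); last exact/funext.
by split; [exact: poly_fun_quad | move=> x; exact: S0].
Qed.

Lemma feasible_conv_bound (l : R) : (0 < n)%N -> 0 <= l ->
  feasible_values Q l -> conv_bound l.
Proof.
move=> n0 l0 [alpha [beta [alphaP _ [_ certP]]]].
have affP i : exists c : 'cV[R]_n * R,
    forall x, alpha i x = (c.1^T *m x) 0 0 + c.2.
  by case: (alphaP i) => -[c [d E]] _; exists (c, d).
have [c cP] := choice affP.
(* Where the coordinates sum to 1, the constant term of [alpha i] can be multiplied by that sum,
   which makes [alpha i] linear. Its coefficients are its values at the vertices, hence
   nonnegative. *)
pose A : 'M[R]_n := \matrix_(i, j) ((c i).1 j 0 + (c i).2).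
have alphaE i (x : 'cV[R]_n) : \sum_j x j 0 = 1 -> alpha i x = (A *m x) i 0.
  move=> x1; rewrite cP -[(c i).2]mulr1 -x1 !mxE mulr_sumr -big_split /=.
  by apply: eq_bigr => j _; rewrite !mxE mulrDl.
have A0 i j : 0 <= A i j.
  have : 0 <= alpha i (delta_mx j 0).
    by case: (alphaP i) => _; apply; exact: simplex_delta.
  by rewrite alphaE ?sum_delta_cV // -colE mxE.
(* Symmetrizing preserves the quadratic form and the sign of the entries. *)
pose M := 2^-1 *: (A + A^T).
have symM : M^T = M by rewrite /M linearZ linearD /= trmxK addrC.
have M0 i j : 0 <= M i j.
  have -> : M i j = 2^-1 * (A i j + A j i).
    by rewrite [LHS]mxE [X in _ * X]mxE [A^T _ _]mxE.
  by rewrite mulr_ge0 ?invr_ge0 ?addr_ge0.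
have quadM x : quad M x = quad A x.
  by rewrite quadZl quadDl quad_trmx; field.
(* This is the homogenized certificate: the constant [l] becomes [l] times the squared coordinate
   sum. Scaling extends its nonnegativity to all vectors of nonzero sum. *)
pose P := Q - M - l *: const_mx 1.
have symP : P^T = P.
  by rewrite /P !linearB /= [(_ *: const_mx 1)^T]linearZ /= trmx_const symM Qsym.
have quadP x : quad P x = quad Q x - quad M x - l * (\sum_i x i 0) ^+ 2.
  by rewrite !quadBl quadZl quad_const1.
have P1 (x : 'cV[R]_n) : \sum_i x i 0 = 1 -> 0 <= quad P x.
  move=> x1; rewrite quadP x1 expr1n mulr1 quadM.
  have := certP x; have -> : ((ones R n)^T *m x) 0 0 = 1.
    by rewrite mxE -x1; apply: eq_bigr => i _; rewrite !mxE mul1r.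
  rewrite subrr mulr0 addr0.
  have -> : \sum_i alpha i x * - x i 0 = - quad A x.
    rewrite quadE -sumrN; apply: eq_bigr => i _.
    by rewrite alphaE // mulrN mulrC.
  by lra.
have PN0 (x : 'cV[R]_n) : \sum_i x i 0 != 0 -> 0 <= quad P x.
  move=> s0; have := P1 ((\sum_i x i 0)^-1 *: x).
  rewrite quadZ pmulr_rge0; last by rewrite exprn_even_gt0 // invr_eq0.
  by apply; under eq_bigr do rewrite mxE; rewrite -mulr_sumr mulVf.
(* A vector of sum 0 is a limit of vectors [x + t *: e] of sum t > 0. *)
have P0 x : 0 <= quad P x.
  have [s0|] := eqVneq (\sum_i x i 0) 0; last exact: PN0.
  pose e : 'cV[R]_n := delta_mx (Ordinal n0) 0.
  apply: (@ge0_small _ _ (2 * (x^T *m P *m e) 0 0) (quad P e)) => t /andP[t0 _].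
  have : 0 <= quad P (x + t *: e).
    apply: PN0; under eq_bigr do rewrite !mxE.
    rewrite big_split /= s0 add0r -mulr_sumr (eq_bigr (fun i => e i 0)).
      by rewrite sum_delta_cV mulr1 gt_eqF.
    by move=> i _; rewrite mxE.
  rewrite quadDr // quadZ -scalemxAr [X in 2 * X]mxE.
  by move=> H; rewrite mulrDr mulrA -expr2 mulrCA addrA.
(* Adding back the diagonal of [M] restores the diagonal of [Q]; off the diagonal, [Q - S] is [M],
   which is nonnegative. The added term can only increase the form. *)
pose S := Q - M + diag_mx (diag M).
have quadS x : quad S x = quad Q x - quad M x + \sum_i M i i * x i 0 ^+ 2.
  rewrite quadDl quadBl quad_diag; congr (_ + _).
  by apply: eq_bigr => i _; rewrite [diag M _ _]mxE.
have Dge0 (x : 'cV[R]_n) : 0 <= \sum_i M i i * x i 0 ^+ 2.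
  by apply: sumr_ge0 => i _; rewrite mulr_ge0 ?sqr_ge0.
have Sl (x : 'cV[R]_n) : l * (\sum_i x i 0) ^+ 2 <= quad S x.
  by rewrite quadS; have := P0 x; have := Dge0 x; rewrite quadP; lra.
exists S.
  split.
  - split=> [|x]; first by
      rewrite /S linearD linearB /= tr_diag_mx symM Qsym.
    (* Here [0 <= l] makes the lower bound [Sl] nonnegative on all vectors. *)
    by apply: (le_trans _ (Sl x)); rewrite mulr_ge0 ?sqr_ge0.
  - move=> i j; have := M0 i j; rewrite /S.
    by rewrite !mxE; case: eqP => [->|_]; rewrite ?mulr1n ?mulr0n; lra.
  - by apply/rowP => i; rewrite !mxE eqxx mulr1n; ring.
by move=> x [_ x1]; have := Sl x; rewrite x1 expr1n mulr1.
Qed.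

End Relaxation.

(** * Equality of the two optimal values *)

Lemma ereal_sup_max (R : realType) (A : set R) (m : R) :
  A m -> (forall l, A l -> l <= m) -> ereal_sup [set l%:E | l in A] = m%:E.
Proof.
move=> Am Amax; apply/le_anti/andP; split.
  by apply: ge_ereal_sup => _ [l Al <-]; rewrite lee_fin; exact: Amax.
by apply: ereal_sup_ubound; exists m.
Qed.

Theorem theorem4 (R : realType) (n : nat) (hn : (0 < n)%N) (Q : 'M[R]_n)
    (Qsym : Q^T = Q) (Qnonneg : nonneg_mx Q) :
  l_conv Q = optimal_value Q /\
  exists2 l : R, feasible_values Q l & optimal_value Q = l%:E.
Proof.
have [m [mb m0 mmax]] := conv_bound_max hn Qnonneg.
have convm : conv_values Q m.
  (* The true minimum of a matrix witnessing [m] is itself a bound, so maximality of [m] forces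
     equality. *)
  have [m' m'conv mm'] := conv_bound_values hn mb.
  suff <- : m' = m by [].
  apply/le_anti; rewrite mm' andbT; apply: mmax; first exact: le_trans mm'.
  exact: conv_values_bound.
have feasmax l : feasible_values Q l -> l <= m.
  (* Certificates yield admissible matrices only for nonnegative levels; a negative level lies below
     [m] because [0 <= m]. *)
  move=> lf; have [l0|/ltW l0] := leP 0 l; last exact: le_trans m0.
  by apply: mmax => //; exact: feasible_conv_bound.
have feasm : feasible_values Q m by exact: conv_values_feasible.
have optE : optimal_value Q = m%:E by exact: ereal_sup_max.
split; last by exists m.
rewrite optE; apply: ereal_sup_max => // l lconv.
by apply: feasmax; exact: conv_values_feasible.
Qed.
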